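(* Let $\Sigma^*\to G$, $w\mapsto\overline w$, be a choice of generators for a group $G$, let $\#$ be a letter not in $\Sigma$, and let $\Sigma_\epsilon=\Sigma\cup\{\epsilon\}$ where $\epsilon$ is the empty word. For a combing $R\subset\Sigma^*$ and $g\in G$ put $C(g)=\{u\#w\mid u,w\in R,\ \overline u\, g\,\overline w=1\}$. Then there exists a combing $R\subset\Sigma^*$ such that $C(\overline a)$ is context-free for all $a\in\Sigma_\epsilon$ if and only if $G$ is asynchronously automatic with respect to some combing $R'\subset\Sigma^*$ that is closed under taking formal inverses (i.e. $w\in R'$ implies $w^{-1}\in R'$).
   Context: A choice of generators for a group $G$ consists of a finite alphabet $\Sigma$ equipped with formal inverses (a permutation $a\mapsto a^{-1}$ of $\Sigma$ all of whose orbits have length two, extended to $\Sigma^*$ by $(wv)^{-1}=v^{-1}w^{-1}$) together with a surjective monoid homomorphism $\Sigma^*\to G$, $w\mapsto\overline{w}$, satisfying $\overline{w^{-1}}=\overline{w}^{-1}$. A combing is a language $R\subset\Sigma^*$ mapping onto $G$. A rational transduction $\Sigma^*\to\Sigma^*$ is a rational subset of the monoid $\Sigma^*\times\Sigma^*$ (i.e. a subset in the closure of the finite subsets under union, product and generation of submonoid; equivalently a set of labels of accepted paths of a finite automaton with edge labels in $\Sigma^*\times\Sigma^*$). $G$ is asynchronously automatic with respect to a combing $R'$ if $R'$ is a regular language and for every $a\in\Sigma_\epsilon$ the relation $\{(u,w)\mid u,w\in R',\ \overline u\,\overline a=\overline w\}$ is a rational transduction (this is equivalent to the standard definition via asynchronous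 automata). *)

(* Defs.v *)
From mathcomp Require Import all_boot.
Set Implicit Arguments. Unset Strict Implicit. Unset Printing Implicit Defensive.

Definition is_group (G : Type) (mul : G -> G -> G) (one : G) (inv : G -> G) : Prop :=
  [/\ forall x y z, mul x (mul y z) = mul (mul x y) z,
      forall x, mul one x = x, forall x, mul x one = x,
      forall x, mul (inv x) x = one & forall x, mul x (inv x) = one].

Definition formal_inverse (S : finType) (finv : S -> S) : Prop :=
  involutive finv /\ forall a, finv a != a.

Definition winv (S : Type) (finv : S -> S) (w : seq S) : seq S := rev (map finv w).

Definition choice_of_generators (S : finType) (finv : S -> S)
  (G : Type) (mul : G -> G -> G) (one : G) (inv : G -> G) (f : seq S -> G) : Prop :=
  [/\ formal_inverse finv,
      f [::] = one,
      forall u v, f (u ++ v) = mul (f u) (f v),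
      (forall g, exists w, f w = g) &
      forall w, f (winv finv w) = inv (f w)].

Definition language (T : Type) := seq T -> Prop.

Definition combing (S G : Type) (f : seq S -> G) (R : language S) : Prop :=
  forall g, exists w, R w /\ f w = g.

Definition eps_word (S : Type) (a : option S) : seq S :=
  if a is Some x then [:: x] else [::].

Definition regular (T : Type) (L : language T) : Prop :=
  exists (Q : finType) (q0 : Q) (delta : Q -> T -> Q) (F : pred Q),
    forall w, L w <-> F (foldl delta q0 w).

Section CFG.
Variables (N T : finType) (prods : seq (N * seq (N + T))).
Inductive dsym : N + T -> seq T -> Prop :=
| dsym_T t : dsym (inr t) [:: t]
| dsym_N A rhs w : (A, rhs) \in prods -> dseq rhs w -> dsym (inl A) w
with dseq : seq (N + T) -> seq T -> Prop :=
| dseq_nil : dseq [::] [::]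
| dseq_cons x r u v : dsym x u -> dseq r v -> dseq (x :: r) (u ++ v).
End CFG.

Definition context_free (T : finType) (L : language T) : Prop :=
  exists (N : finType) (start : N) (prods : seq (N * seq (N + T))),
    forall w, L w <-> dsym prods (inl start) w.

Section Transducer.
Variables (Q T : finType) (edges : seq (Q * (seq T * seq T) * Q)).
Inductive trun : Q -> Q -> seq T -> seq T -> Prop :=
| trun_nil q : trun q q [::] [::]
| trun_step q u v q' q'' u' v' :
    (q, (u, v), q') \in edges -> trun q' q'' u' v' -> trun q q'' (u ++ u') (v ++ v').
End Transducer.

Definition rational_transduction (T : finType) (Rel : seq T -> seq T -> Prop) : Prop :=
  exists (Q : finType) (I F : pred Q) (edges : seq (Q * (seq T * seq T) * Q)),
    forall u w, Rel u w <-> exists q q', [/\ I q, F q' & trun edges q q' u w].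

Definition async_automatic (S : finType) (G : Type) (mul : G -> G -> G)
  (f : seq S -> G) (R' : language S) : Prop :=
  combing f R' /\ regular R' /\
  forall a : option S,
    rational_transduction
      (fun u w => [/\ R' u, R' w & mul (f u) (f (eps_word a)) = f w]).

(* ---------- the language C(g) over Sigma u {#}; None plays the role of # ---------- *)
Definition Clang (S G : Type) (mul : G -> G -> G) (one : G) (f : seq S -> G)
  (R : language S) (g : G) : language (option S) :=
  fun x => exists u w, [/\ R u, R w, mul (mul (f u) g) (f w) = one &
                          x = map Some u ++ None :: map Some w].

(* Main.v *)
(** In the grammar of [C(g)] every derivation tree has a path leading down to
  #, and each nonterminal off that path derives, in a given context, words
  representing a single group element.  Printing what lies on either side of the
  path, as long as the side words have bounded length, is therefore a rational
  transduction contained in [C(g)]; the point is to make the side words bounded.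

  For [u] and [w] of minimal length among the words of [R] with the same value
  they are, since a nonterminal off the path may be replaced by the shortest word
  it derives.  The domain [D] of the transduction obtained for [C(1)] is thus a
  regular set with [D] contained in [R] and still mapping onto [G].  Now call a
  word shortenable if some shorter word has the same value and acts in the same
  way on the automaton of [D], and let [P] be the set of words of [D] without a
  shortenable factor of length at most [n]; [P] is regular, and it contains the
  shortest words of [D], hence is a combing.  A long word derived off the path
  contains a factor of medium length derived from a nonterminal, which is
  shortenable when [n] is large; so for [u] and [w] in [P] the side words are
  bounded again.  This makes the multiplication relations between [P] and its
  inverse [P'] rational, and those inside [P] or inside [P'] are compositions of
  two such relations.  The combing is the union of [P] and [P'].

  Conversely the transductions of an asynchronously automatic structure closed
  under inverses yield linear grammars for [C(a)] by inverting the second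
  component. *)

Require Import Defs.
From mathcomp Require Import all_boot.
From mathcomp Require Import boolp.

Set Implicit Arguments.
Unset Strict Implicit.
Unset Printing Implicit Defensive.

(** * Finite bounds and words of minimal length *)

Lemma uniform_bound (I : finType) (P : I -> nat -> Prop) :
  (forall i m n, m <= n -> P i m -> P i n) ->
  (forall i, exists n, P i n) -> exists n, forall i, P i n.
Proof.
move=> mono /choice[g gP]; exists (\max_i g i) => i.
by apply: mono (gP i); apply: leq_bigmax.
Qed.

Lemma shortest (T : Type) (P : seq T -> Prop) :
  (exists w, P w) -> exists2 w, P w & forall v, P v -> size w <= size v.
Proof.
move=> [w Pw].
have exn : exists n, `[< exists2 v, P v & size v = n >].
  by exists (size w); apply/asboolP; exists w.
case: (ex_minnP exn) => n /asboolP[v Pv <-] minv.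
by exists v => // u Pu; apply: minv; apply/asboolP; exists u.
Qed.

(** * Regular languages *)

(* Myhill-Nerode: reading [t] in state [q] means appending [t] to a chosen word of
   class [q]. *)
Lemma regular_of_finite_index (T : Type) (L : language T) (K : finType)
    (k : seq T -> K) :
  (forall u v z, k u = k v -> L (u ++ z) -> L (v ++ z)) -> regular L.
Proof.
move=> kL.
(* A class that [k] never attains gets a junk representative; no run from [k [::]] meets such a
   class. *)
have /choice[rep repP] : forall q, exists w, (exists v, k v = q) -> k w = q.
  move=> q; case: (pselect (exists v, k v = q)) => [[v <-]|nq].
    by exists v.
  by exists [::].
pose delta q t := k (rcons (rep q) t).
exists K, (k [::]), delta, (fun q => `[< L (rep q) >]).
suff kP z : forall w, L (w ++ z) <-> `[< L (rep (foldl delta (k w) z)) >].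
  by move=> w; apply: (kP w [::]).
elim: z => [|t z IH] w /=; have kw : k (rep (k w)) = k w by apply: repP; exists w.
  rewrite cats0; split=> [Lw|/asboolP].
    by apply/asboolP; have := kL w (rep (k w)) [::]; rewrite !cats0; apply.
  by have := kL (rep (k w)) w [::]; rewrite !cats0; apply.
rewrite -[foldl _ _ _]/(foldl delta (k (rcons (rep (k w)) t)) z) -IH -cats1 -catA.
by split; apply: kL.
Qed.

Lemma regularI (T : Type) (L1 L2 : language T) :
  regular L1 -> regular L2 -> regular (fun w => L1 w /\ L2 w).
Proof.
move=> [Q1 [q1 [d1 [F1 L1P]]]] [Q2 [q2 [d2 [F2 L2P]]]].
apply: (@regular_of_finite_index _ _ _ (fun w => (foldl d1 q1 w, foldl d2 q2 w))).
by move=> u v z [e1 e2]; rewrite !L1P !L2P !foldl_cat e1 e2.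
Qed.

Lemma regular_winv (T : finType) (finv : T -> T) (L : language T) :
  regular L -> regular (fun w => L (winv finv w)).
Proof.
move=> [Q [q0 [d [F LP]]]].
(* Appending to [w] prepends to its inverse, so one state does not suffice: the class of [w] is the
   map on states induced by its inverse. *)
pose k w := [ffun q => foldl d q (winv finv w)].
apply: (@regular_of_finite_index _ _ _ k) => u v z /ffunP e.
rewrite !LP /winv !map_cat !rev_cat !foldl_cat.
by have := e (foldl d q0 (winv finv z)); rewrite !ffunE => ->.
Qed.

Lemma cat_eq_cat (T : Type) (a b c d : seq T) : a ++ b = c ++ d ->
  (exists e, a = c ++ e /\ d = e ++ b) \/ (exists e, c = a ++ e /\ b = e ++ d).
Proof.
elim: a c => [|x a IH] [|y c] /=.
- by move=> ->; left; exists [::].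
- by move=> ->; right; exists (y :: c).
- by move=> <-; left; exists (x :: a).
- by case=> -> /IH[[e [-> ->]]|[e [-> ->]]]; [left|right]; exists e.
Qed.

Lemma drop_cat_leq (T : Type) (m : nat) (a b : seq T) :
  m <= size a -> drop m (a ++ b) = drop m a ++ b.
Proof.
rewrite drop_cat leq_eqVlt => /orP[/eqP ->|-> //].
by rewrite ltnn subnn drop0 drop_size.
Qed.

(** A factor of [w ++ z] of length at most [n] either ends inside [w] or starts within its last [n]
    letters. The class of [w] thus need only record those letters and whether [w] itself avoids bad
    factors. *)
Lemma regular_avoiding (T : finType) (bad : seq T -> Prop) (n : nat) :
  regular (fun w => forall x v y, w = x ++ v ++ y -> size v <= n -> ~ bad v).
Proof.
set Av := fun w => _.
pose last_n (w : seq T) := drop (size w - n) w.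
have sz w : size (last_n w) <= n by rewrite size_drop leq_subLR addnC -leq_subLR.
have avE w z : Av (w ++ z) <-> Av w /\ Av (last_n w ++ z).
  split=> [H|[H1 H2] x v y e vn].
    split=> x v y e; first by apply: (H x v (y ++ z)); rewrite e !catA.
    by apply: (H (take (size w - n) w ++ x) v y);
      rewrite -catA -e catA cat_take_drop.
  have [xvw|wxv] := leqP (size (x ++ v)) (size w).
    move: e; rewrite catA => /cat_eq_cat[[t [wE _]]|[t [xvE tE]]].
      by apply: (H1 x v t) => //; rewrite wE catA.
    have t0 : t = [::].
      by apply/size0nil; move: xvw; rewrite xvE size_cat; case: (size t) => // m;
        rewrite addnS ltnNge leq_addr.
    by apply: (H1 x v [::]) => //; rewrite cats0 xvE t0 cats0.
  have wx : size w - n <= size x.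
    by rewrite leq_subLR (leq_trans (ltnW wxv)) // size_cat addnC leq_add2r.
  apply: (H2 (drop (size w - n) x) v y) => //.
  by have := congr1 (drop (size w - n)) e; rewrite !drop_cat_leq ?leq_subr.
pose k w : n.-bseq T * bool := (Bseq (sz w), `[< Av w >]).
apply: (@regular_of_finite_index _ _ _ k) => u v z [e1 e2].
rewrite -/(Av _) avE -/(Av _) => -[Avu Avz]; apply/avE; split.
  by apply/asboolP; rewrite -e2; apply/asboolP.
by rewrite -e1.
Qed.

(** * Rational transductions *)

Inductive prun (Q T : Type) (E : Q -> seq T -> seq T -> Q -> Prop) :
  Q -> Q -> seq T -> seq T -> Prop :=
| prun_nil q : prun E q q [::] [::]
| prun_step q u v q' q'' u' v' :
    E q u v q' -> prun E q' q'' u' v' -> prun E q q'' (u ++ u') (v ++ v').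

(** Words of bounded length over a finite alphabet are finitely many, so the bound [K] replaces the
    finite edge list and edges may be given by any proposition. *)
Definition rational (T : finType) (Rel : seq T -> seq T -> Prop) : Prop :=
  exists (Q : finType) (I F : Q -> Prop) (E : Q -> seq T -> seq T -> Q -> Prop)
         (K : nat),
    (forall q u v q', E q u v q' -> size u <= K /\ size v <= K) /\
    forall u w, Rel u w <-> exists q q', [/\ I q, F q' & prun E q q' u w].

Lemma rational_transductionP (T : finType) (Rel : seq T -> seq T -> Prop) :
  rational_transduction Rel <-> rational Rel.
Proof.
split=> [[Q [I [F [edges RelP]]]]|[Q [I [F [E [K [EK RelP]]]]]]].
  pose len (e : Q * (seq T * seq T) * Q) := size e.1.2.1 + size e.1.2.2.
  exists Q, I, F, (fun q u v q' => (q, (u, v), q') \in edges).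
  exists (\max_(e <- edges) len e); split=> [q u v q' e_in|u w].
    have le : len (q, (u, v), q') <= \max_(e <- edges) len e.
      exact: leq_bigmax_seq.
    by split; apply: leq_trans le; rewrite ?leq_addr ?leq_addl.
  rewrite RelP; split=> -[q [q' [Iq Fq' r]]]; exists q, q'; split=> //.
    by elim: r => [?|? ? ? ? ? ? ? ? _]; [left|apply: prun_step].
  by elim: r => [?|? ? ? ? ? ? ? ? _]; [left|apply: trun_step].
pose D : finType := (Q * (K.-bseq T * K.-bseq T) * Q)%type.
pose edges := [seq (d.1.1, (val d.1.2.1, val d.1.2.2), d.2) |
  d <- enum D & `[< E d.1.1 (val d.1.2.1) (val d.1.2.2) d.2 >]].
have edgesP q u v q' : (q, (u, v), q') \in edges <-> E q u v q'.
  split=> [/mapP[[[p [x y]] p']]|H].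
    by rewrite mem_filter => /andP[/asboolP H _] [-> -> -> ->].
  have [uK vK] := EK _ _ _ _ H.
  apply/mapP; exists (q, (Bseq uK, Bseq vK), q') => //.
  by rewrite mem_filter mem_enum andbT; apply/asboolP.
exists Q, (fun q => `[< I q >]), (fun q => `[< F q >]), edges => u w.
rewrite RelP; split=> -[q [q' [Iq Fq' r]]]; exists q, q'.
  split; try exact/asboolP.
  elim: r => [?|p x y p' p'' ? ? Ep _]; first by left.
  by apply: trun_step; apply/edgesP.
split; try exact/asboolP.
elim: r => [?|p x y p' p'' ? ? Ep _]; first by left.
by apply: prun_step; apply/edgesP.
Qed.

Lemma rational_ext (T : finType) (R1 R2 : seq T -> seq T -> Prop) :
  (forall u w, R1 u w <-> R2 u w) -> rational R1 -> rational R2.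
Proof.
move=> R12 [Q [I [F [E [K [EK RP]]]]]]; exists Q, I, F, E, K; split=> // u w.
by rewrite -R12.
Qed.

Lemma rational_swap (T : finType) (R : seq T -> seq T -> Prop) :
  rational R -> rational (fun u w => R w u).
Proof.
move=> [Q [I [F [E [K [EK RP]]]]]].
exists Q, I, F, (fun q u v q' => E q v u q'), K.
split=> [q u v q' /EK[]|u w] //.
rewrite RP; split=> -[q [q' [Iq Fq' r]]]; exists q, q'; split=> //.
  by elim: r => [?|? ? ? ? ? ? ? ? _]; [left|apply: prun_step].
by elim: r => [?|? ? ? ? ? ? ? ? _]; [left|apply: (prun_step (E := E))].
Qed.

Lemma rationalU (T : finType) (R1 R2 : seq T -> seq T -> Prop) :
  rational R1 -> rational R2 -> rational (fun u w => R1 u w \/ R2 u w).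
Proof.
move=> [Q1 [I1 [F1 [E1 [K1 [EK1 RP1]]]]]] [Q2 [I2 [F2 [E2 [K2 [EK2 RP2]]]]]].
pose E (q : Q1 + Q2) u v (q' : Q1 + Q2) := match q, q' with
  | inl p, inl p' => E1 p u v p' | inr p, inr p' => E2 p u v p'
  | _, _ => False end.
pose sumP (A1 : Q1 -> Prop) (A2 : Q2 -> Prop) q :=
  match q with inl p => A1 p | inr p => A2 p end.
exists (Q1 + Q2)%type, (sumP I1 I2), (sumP F1 F2), E, (maxn K1 K2).
split=> [[p|p] u v [p'|p'] //= H|u w].
- by have [? ?] := EK1 _ _ _ _ H; rewrite !leq_max; split; apply/orP; left.
- by have [? ?] := EK2 _ _ _ _ H; rewrite !leq_max; split; apply/orP; right.
have run1 p q : prun E (inl p) q u w <-> exists2 p', q = inl p' & prun E1 p p' u w.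
  split=> [r|[p' -> r]].
    move e: (inl p) r => s r; elim: r p e => [? p <-|q0 x y q1 q2 x' y'].
      by exists p => //; left.
    move=> Eq _ IH p e; rewrite -e /= in Eq; case: q1 Eq IH => // p1 Ep IH.
    by have [p' -> ?] := IH p1 erefl; exists p' => //; apply: prun_step Ep _.
  by elim: r => [?|? ? ? ? ? ? ? Ep _ IH]; [left|apply: prun_step IH].
have run2 p q : prun E (inr p) q u w <-> exists2 p', q = inr p' & prun E2 p p' u w.
  split=> [r|[p' -> r]].
    move e: (inr p) r => s r; elim: r p e => [? p <-|q0 x y q1 q2 x' y'].
      by exists p => //; left.
    move=> Eq _ IH p e; rewrite -e /= in Eq; case: q1 Eq IH => // p1 Ep IH.
    by have [p' -> ?] := IH p1 erefl; exists p' => //; apply: prun_step Ep _.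
  by elim: r => [?|? ? ? ? ? ? ? Ep _ IH]; [left|apply: prun_step IH].
rewrite RP1 RP2; split.
  by move=> [] [p [p' [Ip Fp' r]]]; [exists (inl p), (inl p')|exists (inr p), (inr p')];
    split=> //; [apply/run1|apply/run2]; exists p'.
by move=> [[p|p] [q [Ip Fq /[dup] r]]];
  [move=> /run1|move=> /run2] => -[p' qE ?]; rewrite qE in Fq; [left|right]; exists p, p'.
Qed.

(** Product construction: each edge moves the automata of [A] and [B] along its whole labels. *)
Lemma rational_restrict (T : finType) (R : seq T -> seq T -> Prop)
    (A B : language T) :
  rational R -> regular A -> regular B ->
  rational (fun u w => [/\ R u w, A u & B w]).
Proof.
move=> [Q [I [F [E [K [EK RP]]]]]] [QA [a0 [dA [FA AP]]]] [QB [b0 [dB [FB BP]]]].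
pose E' (s : Q * QA * QB) u v (t : Q * QA * QB) :=
  [/\ E s.1.1 u v t.1.1, t.1.2 = foldl dA s.1.2 u & t.2 = foldl dB s.2 v].
exists (Q * QA * QB)%type, (fun s => [/\ I s.1.1, s.1.2 = a0 & s.2 = b0]),
  (fun s => [/\ F s.1.1, FA s.1.2 & FB s.2]), E', K.
split=> [s u v t [/EK]|u w] //.
have runE s t : prun E' s t u w <->
    [/\ prun E s.1.1 t.1.1 u w, t.1.2 = foldl dA s.1.2 u & t.2 = foldl dB s.2 w].
  split=> [r|].
    elim: r => [?|s0 x y s1 s2 x' y' [Es eA eB] _ [r eA' eB']]; first by split=> //; left.
    by split; [apply: prun_step Es r|rewrite eA' eA foldl_cat|rewrite eB' eB foldl_cat].
  case: s t => [[q a] b] [[q' a'] b'] /= [r -> ->] {a' b'}.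
  elim: r a b => [p a b|p x y p' p'' x' y' Ep _ IH a b]; first by left.
  by rewrite !foldl_cat; apply: prun_step (IH _ _); split.
rewrite (propext (RP u w)) (propext (AP u)) (propext (BP w)).
split=> [[[q [q' [Iq Fq' r]]] Au Bw]|[s [t [[Is sA sB] [Ft tA tB]]]]].
  exists (q, a0, b0), (q', foldl dA a0 u, foldl dB b0 w); split=> //.
  exact/runE.
move=> /runE[r eA eB]; split; first by exists s.1.1, t.1.1.
  by rewrite -sA -eA.
by rewrite -sB -eB.
Qed.

(** An edge may straddle the cut between [u] and [z]. The class of [u] therefore collects the pairs
    of a state [q] and an overshoot [x] of at most [K] letters such that some run from an initial
    state reads [u ++ x] and ends in [q]. *)
Lemma regular_domain (T : finType) (R : seq T -> seq T -> Prop) :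
  rational R -> regular (fun u => exists w, R u w).
Proof.
move=> [Q [I [F [E [K [EK RP]]]]]].
pose K' : finType := {set Q * K.-bseq T}.
pose k (w : seq T) : K' := [set s : Q * K.-bseq T |
  `[< exists q y, I q /\ prun E q s.1 (w ++ s.2) y >]].
have catr p q r u v u' v' : prun E p q u v -> prun E q r u' v' ->
    prun E p r (u ++ u') (v ++ v').
  by elim=> [//|p0 x y p1 p2 x' y' Ep _ IH /IH]; rewrite -!catA; apply: prun_step.
have split_run p r u z y : prun E p r (u ++ z) y ->
    exists q x z' y1 y2, [/\ size x <= K, z = x ++ z', prun E p q (u ++ x) y1 &
      prun E q r z' y2].
  move e: (u ++ z) => uz run; elim: run u e => [q|p0 x y0 p1 p2 x' y' Ep run IH] u.
    case: u => //= ->; exists q, [::], [::], [::], [::]; split=> //; left.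
  move=> /cat_eq_cat[[e [-> eE]]|[e [xE zE]]].
    have [q [x1 [z' [y1 [y2 [? ? run1 run2]]]]]] := IH _ (esym eE).
    exists q, x1, z', (y0 ++ y1), y2; split=> //.
    by rewrite -catA; apply: prun_step run1.
  exists p1, e, x', y0, y'; split=> //.
    have [+ _] := EK _ _ _ _ Ep.
    by rewrite xE size_cat; apply/leq_trans/leq_addl.
  rewrite -xE -[x]cats0 -[y0]cats0; apply: prun_step Ep _; left.
apply: (@regular_of_finite_index _ _ _ k) => u v z /setP kuv [y].
rewrite RP => -[p [r [Ip Fr /split_run]]] [q [x [z' [y1 [y2 [xK -> run1 run2]]]]]].
have := kuv (q, Bseq xK); rewrite !inE => e.
have /asboolP[p' [y' [Ip' run']]] :
    `[< exists p y, I p /\ prun E p q (v ++ x) y >].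
  by rewrite -[X in is_true X]e; apply/asboolP; exists p, y1.
exists (y' ++ y2); rewrite RP; exists p', r; split=> //.
by rewrite catA; apply: catr run' run2.
Qed.

Lemma rational_comp (T : finType) (R1 R2 : seq T -> seq T -> Prop) :
  rational R1 -> rational R2 ->
  rational (fun u w => exists z, R1 u z /\ R2 z w).
Proof.
move=> [Q1 [I1 [F1 [E1 [K1 [EK1 RP1]]]]]] [Q2 [I2 [F2 [E2 [K2 [EK2 RP2]]]]]].
pose K := K1 + K2.
pose Q : finType := (Q1 * Q2 * K.-bseq T)%type.
(* The word in a state is the output of the first transducer which the second
   one has not read yet. *)
pose E (s : Q) u w (t : Q) :=
  (exists v, [/\ E1 s.1.1 u v t.1.1, s.1.2 = t.1.2, t.2 = s.2 ++ v :> seq T & w = [::]])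
  \/ (exists v, [/\ E2 s.1.2 v w t.1.2, s.1.1 = t.1.1,
                   s.2 = v ++ t.2 :> seq T & u = [::]]).
exists Q, (fun s : Q => [/\ I1 s.1.1, I2 s.1.2 & s.2 = [::] :> seq T]),
  (fun s : Q => [/\ F1 s.1.1, F2 s.1.2 & s.2 = [::] :> seq T]), E, K.
split=> [s u w t [] [v [H _ _ ->]]|u w].
- by have [uK _] := EK1 _ _ _ _ H; split=> //; apply: leq_trans uK (leq_addr _ _).
- by have [_ wK] := EK2 _ _ _ _ H; split=> //; apply: leq_trans wK (leq_addl _ _).
have read2 s w1 s' t u1 w2 : E s [::] w1 s' -> prun E s' t u1 w2 ->
    prun E s t u1 (w1 ++ w2) by apply: prun_step.
have read1 s u1 s' t u2 w1 : E s u1 [::] s' -> prun E s' t u2 w1 ->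
    prun E s t (u1 ++ u2) w1 by apply: (@prun_step _ _ E s u1 [::]).
split=> [[z []]|[s [t [[Is1 Is2 s0] [Ft1 Ft2 t0] r]]]].
  rewrite RP1 RP2 => -[p1 [f1 [Ip1 Ff1 r1]]] [p2 [f2 [Ip2 Ff2 r2]]].
  have K0 : size ([::] : seq T) <= K by [].
  exists (p1, p2, Bseq K0), (f1, f2, Bseq K0); split=> //.
  (* For the induction, the second run first consumes an arbitrary buffered word [x]. *)
  suff main p1' p2' x (xK : size x <= K) y :
      prun E1 p1' f1 u y -> prun E2 p2' f2 (x ++ y) w ->
      prun E (p1', p2', Bseq xK) (f1, f2, Bseq K0) u w.
    exact: (main p1 p2 [::] K0 z).
  move=> {r1 r2} r1; elim: r1 p2' x xK w {p1 p2 z Ip1 Ip2} => {p1' y Ff1 f1 u}.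
    move=> q p2 x xK w; rewrite cats0 => r2.
    elim: r2 xK => [q2 xK|q2 v w' q2' q2'' x' w'' Eq _ IH xK].
      by rewrite (bool_irrelevance xK K0); left.
    have x'K : size x' <= K.
      by apply: leq_trans xK; rewrite size_cat leq_addl.
    apply: read2 (IH x'K); right.
    by exists v.
  move=> q u0 v q' q'' u' y Eq _ IH p2 x xK w r2.
  move e: (x ++ v ++ y) r2 => xy r2.
  elim: r2 x xK e IH => [q2|q2 v2 w2 q2' q2'' y2 w2' Eq2 r2 IH2] x xK e IH.
    case: x xK e => // xK; case: v Eq => // Eq; case: y IH => // IH e.
    apply: read1 (IH q2 [::] K0 [::] _); last by left.
    by left; exists [::].
  (* The second transducer moves whenever the buffer [x] holds its next label [v2]. Otherwise [x] is
     shorter than [K2], and an edge of the first adds at most [K1] letters, so the bound [K] is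
     respected. *)
  have [v2x|xv2] := leqP (size v2) (size x).
    have [x' xE] : exists x', x = v2 ++ x'.
      move: e => /cat_eq_cat[[x' [-> _]]|[x' [v2E _]]]; first by exists x'.
      exists [::]; rewrite cats0; move: v2x; rewrite v2E size_cat.
      rewrite -{2}[size x]addn0 leq_add2l leqn0 size_eq0 => /eqP ->.
      by rewrite cats0.
    have x'K : size x' <= K.
      by apply: leq_trans xK; rewrite xE size_cat leq_addl.
    have e' : x' ++ v ++ y = y2.
      move: e; rewrite xE -catA => /eqP; rewrite eqseq_cat // eqxx => /eqP //.
    apply: read2 (IH2 x' x'K e' IH); right.
    by exists v2.
  have xvK : size (x ++ v) <= K.
    have [_ vK1] := EK1 _ _ _ _ Eq; have [v2K2 _] := EK2 _ _ _ _ Eq2.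
    rewrite size_cat /K addnC leq_add //.
    by apply: leq_trans v2K2; apply: ltnW.
  have r : prun E2 q2 q2'' ((x ++ v) ++ y) (w2 ++ w2').
    by rewrite -catA e; apply: prun_step Eq2 r2.
  by apply: read1 (IH _ _ xvK _ r); left; exists v.
have [y [r1 r2]] : exists y, prun E1 s.1.1 t.1.1 u y /\ prun E2 s.1.2 t.1.2 (s.2 ++ y) w.
  elim: r t0 {s0 Is1 Is2 Ft1 Ft2} => [q q0|p x y p' p'' x' y' Ep _ IH p0].
    by exists [::]; rewrite q0; split; left.
  have [z [r1 r2]] := IH p0.
  case: Ep => -[v [Ep e1 e2 ->]].
    exists (v ++ z); rewrite catA -e2 e1; split=> //.
    exact: prun_step Ep r1.
  exists z; rewrite e1 e2 -catA; split=> //.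
  exact: prun_step Ep r2.
exists y; rewrite RP1 RP2; split; first by exists s.1.1, t.1.1.
by exists s.1.2, t.1.2; rewrite s0 in r2.
Qed.

(** * Context-free grammars *)

Scheme dsym_mind := Minimality for dsym Sort Prop
  with dseq_mind := Minimality for dseq Sort Prop.
Combined Scheme derivation_ind from dsym_mind, dseq_mind.

Section Derivations.
Variables (N T : finType) (prods : seq (N * seq (N + T))).

Lemma dseq_cat a b u v :
  dseq prods a u -> dseq prods b v -> dseq prods (a ++ b) (u ++ v).
Proof.
by move=> + Hb; elim=> //= x r u1 v1 Hx _ IH; rewrite -catA; apply: dseq_cons.
Qed.

Lemma dseq1 x w : dsym prods x w -> dseq prods [:: x] w.
Proof. by move=> H; rewrite -[w]cats0; apply: dseq_cons H _; left. Qed.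

Lemma dseq_terminals (t : seq T) w : dseq prods (map inr t) w <-> w = t.
Proof.
split=> [|->].
  elim: t w => [|x t IH] w /= H; inversion H as [|x' r' u v Hx Hr e1 e2] => //; subst.
  by inversion Hx; subst; rewrite (IH _ Hr).
by elim: t => [|x t IH] /=; [left|apply: (dseq_cons (u := [:: x])) IH; left].
Qed.

(* A long word derived from a symbol has a factor of controlled length derived
   from a nonterminal: descend in the derivation tree to the last node whose
   yield is longer than [M]. *)
Lemma medium_factor (L : language T) (M b : nat) :
  0 < M -> (forall A rhs, (A, rhs) \in prods -> size rhs <= b) ->
  forall x W, dsym prods x W -> forall X Y,
    (forall W', dsym prods x W' -> L (X ++ W' ++ Y)) ->
    size W <= M \/ exists B X' v Y', [/\ W = X' ++ v ++ Y', dsym prods (inl B) v,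
      M < size v <= b * M &
      forall v', dsym prods (inl B) v' -> L ((X ++ X') ++ v' ++ (Y' ++ Y))].
Proof.
move=> M0 sizeb.
pose med W X Y := exists B X' v Y', [/\ W = X' ++ v ++ Y', dsym prods (inl B) v,
  M < size v <= b * M &
  forall v', dsym prods (inl B) v' -> L ((X ++ X') ++ v' ++ (Y' ++ Y))].
suff [H _] : (forall x W, dsym prods x W -> forall X Y,
    (forall W', dsym prods x W' -> L (X ++ W' ++ Y)) -> size W <= M \/ med W X Y)
  /\ (forall r W, dseq prods r W -> forall X Y,
    (forall W', dseq prods r W' -> L (X ++ W' ++ Y)) ->
    size W <= size r * M \/ med W X Y) by exact: H.
apply: derivation_ind => [t X Y _|A rhs W AP rW IH X Y ctx|X Y _|
  x r u v xu IHu rv IHv X Y ctx].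
- by left.
- have [|le|] := IH X Y; [|case: (leqP (size W) M) => [|lt]; first by left|by right].
    by move=> W' rW'; apply: ctx; apply: dsym_N rW'.
  right; exists A, [::], W, [::]; split; rewrite ?cats0 //.
  + exact: dsym_N rW.
  + by rewrite lt (leq_trans le) // leq_mul2r (sizeb _ _ AP) orbT.
- by left.
- have [|leu|[B [X' [w [Y' [-> Bw sw ctxB]]]]]] := IHu X (v ++ Y).
  + by move=> W' xW'; rewrite (catA W'); apply: ctx; apply: dseq_cons.
  + have [|lev|[B [X' [w [Y' [-> Bw sw ctxB]]]]]] := IHv (X ++ u) Y.
    * by move=> W' rW'; rewrite -catA (catA u); apply: ctx; apply: dseq_cons.
    * by left; rewrite size_cat /= mulSn leq_add.
    * right; exists B, (u ++ X'), w, Y'; by split; rewrite ?catA.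
  + right; exists B, X', w, (Y' ++ v); by split=> //; rewrite -?catA.
Qed.

End Derivations.

(** * Factorizations of words with exactly one # *)

Section Hash.
Variable S : Type.
Implicit Types (u v w : seq S) (X Y : seq (option S)).

Lemma map_eq_cat u X Y : map Some u = X ++ Y ->
  exists u1 u2, [/\ u = u1 ++ u2, X = map Some u1 & Y = map Some u2].
Proof.
elim: u X => [|x u IH] [|y X] //=; first by move=> <-; exists [::], [::].
  by move=> <-; exists [::], (x :: u).
by case=> <- /IH[u1 [u2 [-> -> ->]]]; exists (x :: u1), u2.
Qed.

Lemma hash_inj u v u' v' :
  map Some u ++ None :: map Some v = map Some u' ++ None :: map Some v' ->
  u = u' /\ v = v'.
Proof.
elim: u u' => [|x u IH] [|x' u'] //=; last by case=> -> /IH[-> ->].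
by case=> e; split=> //; apply: inj_map e => x y [].
Qed.

Lemma hash_split X Y u w : X ++ Y = map Some u ++ None :: map Some w ->
  (exists u1 u2, [/\ X = map Some u1, Y = map Some u2 ++ None :: map Some w &
                     u = u1 ++ u2]) \/
  (exists w1 w2, [/\ X = map Some u ++ None :: map Some w1, Y = map Some w2 &
                     w = w1 ++ w2]).
Proof.
move=> /cat_eq_cat[[[|y e] [-> /=]]|[e [/map_eq_cat[u1 [u2 [-> -> ->]]] ->]]].
- by move=> <-; left; exists u, [::]; rewrite !cats0.
- by case=> <- /map_eq_cat[w1 [w2 [-> -> ->]]]; right; exists w1, w2.
- by left; exists u1, u2.
Qed.

End Hash.

Lemma None_notin_map (S : eqType) (u : seq S) : None \notin map Some u.
Proof. by elim: u. Qed.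

Lemma map_Some_hash (S : eqType) (u v : seq S) W :
  map Some u = map Some v ++ None :: W -> False.
Proof.
move=> e; have := None_notin_map u.
by rewrite e mem_cat inE eqxx orbT.
Qed.

Lemma hash_factor (S : eqType) (X V Y : seq (option S)) (u w : seq S) :
  None \notin V -> X ++ V ++ Y = map Some u ++ None :: map Some w ->
  exists v, V = map Some v /\
   ((exists x y, [/\ X = map Some x, Y = map Some y ++ None :: map Some w &
                     u = x ++ v ++ y]) \/
    (exists x y, [/\ X = map Some u ++ None :: map Some x, Y = map Some y &
                     w = x ++ v ++ y])).
Proof.
move=> NV /hash_split[[u1 [u2 [-> /hash_split + ->]]]|].
  case=> [[v [y [-> -> ->]]]|[v [y [VE]]]]; last first.
    by rewrite VE mem_cat inE eqxx orbT in NV.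
  by exists v; split=> //; left; exists u1, y.
move=> [x [w2 [-> /esym/map_eq_cat[v [y [-> -> ->]]] ->]]].
by exists v; split=> //; right; exists x, y.
Qed.

(** * The transducer along the path to # *)

Section Spine.
Variables (S : finType) (finv : S -> S) (N : finType).
Variable prods : seq (N * seq (N + option S)).
Hypothesis finvK : involutive finv.

Lemma winvK : involutive (winv finv).
Proof.
by move=> w; rewrite /winv map_rev revK -map_comp map_id_in // => x _ /=.
Qed.

Lemma winv_cat u v : winv finv (u ++ v) = winv finv v ++ winv finv u.
Proof. by rewrite /winv map_cat rev_cat. Qed.

Lemma size_winv u : size (winv finv u) = size u.
Proof. by rewrite size_rev size_map. Qed.

(* The transducer follows the path from the root of a derivation tree down to
   the leaf #, printing what is derived on the left and, inverted, what is
   derived on the right; side words longer than [K] are not allowed. *)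
Definition spine_edge (K : nat) (s : option N) (u v : seq S) (t : option N) :=
  exists A a b, [/\ s = Some A,
    (A, a ++ (if t is Some B then inl B else inr None) :: b) \in prods,
    dseq prods a (map Some u), dseq prods b (map Some (winv finv v)) &
    size u <= K /\ size v <= K].

(** The terminal case, which can only be #, lets the induction treat every symbol of a right-hand
    side alike. *)
Definition spine_from (K : nat) (x : N + option S) (u w : seq S) : Prop :=
  match x with
  | inl A => prun (spine_edge K) (Some A) None u (winv finv w)
  | inr t => [/\ t = None, u = [::] & w = [::]]
  end.

(** Going down the path, the right side words appear from the outside in, that is from right to
    left; inverting them lets the second tape be written in path order. *)
Lemma spine_sound K s u v : prun (spine_edge K) s None u v ->
  if s is Some A then
    dsym prods (inl A) (map Some u ++ None :: map Some (winv finv v))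
  else u = [::] /\ v = [::].
Proof.
move e: None => s' r; elim: r e => [q <- //|q u1 v1 q' q'' u2 v2 + _ IH /IH].
move=> [A [a [b [-> AP au bv _]]]] {}IH; apply: dsym_N AP _.
rewrite map_cat winv_cat map_cat -catA -cat_cons (catA (map Some u2)).
apply: dseq_cat au _; rewrite -cat1s; apply: dseq_cat bv; apply: dseq1.
by case: q' IH => [B|[-> ->]] //=; left.
Qed.

Section Complete.
Variables (L : language (option S)) (M b : nat) (W0 : seq (option S)).
Hypothesis M0 : 0 < M.
Hypothesis sizeb : forall A rhs, (A, rhs) \in prods -> size rhs <= b.
(** [W0] is the whole word under analysis. The clause on [v'] says that every yield of [B] may be
    substituted in this place without leaving [L]; replacement arguments will supply [M] from it. *)
Hypothesis boundM : forall X B v Y, X ++ v ++ Y = W0 -> None \notin v ->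
  dsym prods (inl B) v ->
  (forall v', dsym prods (inl B) v' -> L (X ++ v' ++ Y)) -> size v <= M.

(** The bound is summed over the symbols of [r]: a nonterminal falls under [boundM], in the context
    where its siblings keep their yields, and a terminal has length 1, at most [M]. *)
Lemma side_bound r V X Y : dseq prods r V -> None \notin V ->
  X ++ V ++ Y = W0 -> (forall V', dseq prods r V' -> L (X ++ V' ++ Y)) ->
  size V <= size r * M.
Proof.
move=> rV; elim: rV X => [//|x {}r u v xu rv IH] X; rewrite mem_cat negb_or.
move=> /andP[Nu Nv] XY ctx; rewrite size_cat mulSn leq_add //.
  case: x xu ctx => [B|t] xu ctx; last by inversion xu.
  apply: (boundM (X := X) (Y := v ++ Y) _ Nu xu); first by rewrite -XY !catA.
  by move=> v' Bv'; rewrite (catA v'); apply: ctx; apply: dseq_cons.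
apply: (IH (X ++ u)) => //; first by rewrite -XY !catA.
by move=> V' rV'; rewrite -catA (catA u); apply: ctx; apply: dseq_cons.
Qed.

(** The part on sequences isolates the one symbol [x] whose yield contains #. Its claim stays
    quantified over contexts, since the right one is known only where the production is applied. The
    side words come from at most [b] symbols each, whence [b * M]. *)
Lemma spine_complete_rec :
  (forall x W, dsym prods x W -> forall X Y u w,
     W = map Some u ++ None :: map Some w -> X ++ W ++ Y = W0 ->
     (forall W', dsym prods x W' -> L (X ++ W' ++ Y)) ->
     spine_from (b * M) x u w) /\
  (forall r W, dseq prods r W -> forall u w,
     W = map Some u ++ None :: map Some w ->
     exists a x c u1 u2 w1 w2,
       [/\ r = a ++ x :: c, u = u1 ++ u2, w = w1 ++ w2, dseq prods a (map Some u1) &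
        [/\ dseq prods c (map Some w2),
         dsym prods x (map Some u2 ++ None :: map Some w1) & forall X Y,
     X ++ (map Some u2 ++ None :: map Some w1) ++ Y = W0 ->
     (forall W', dsym prods x W' -> L (X ++ W' ++ Y)) ->
     spine_from (b * M) x u2 w1]]).
Proof.
apply: derivation_ind => [t X Y u w|A rhs W AP rW IH X Y u w WE XY ctx|u w|].
- by case: u => [|x [|y u]] //=; case: w => // [[->]].
- have [a [x [c [u1 [u2 [w1 [w2 [rE uE wE au [cw xW stepH]]]]]]]]] := IH _ _ WE.
  move: WE; rewrite uE wE !map_cat -catA => WE.
  rewrite rE in AP; have le := sizeb AP.
  have XY1 : (X ++ map Some u1) ++ (map Some u2 ++ None :: map Some w1) ++
      (map Some w2 ++ Y) = W0 by rewrite -XY WE -!catA /= -!catA.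
  have step := stepH _ _ XY1; rewrite /spine_from winv_cat.
  have edge t : (if t is Some B then inl B else inr None) = x ->
      spine_edge (b * M) (Some A) u1 (winv finv w2) t.
    move=> tx; exists A, a, c; split=> //; rewrite ?tx ?winvK ?size_winv //.
    have lea : size a <= b by apply: leq_trans le; rewrite size_cat leq_addr.
    have lec : size c <= b.
      by apply: leq_trans le; rewrite size_cat /= addnS ltnW // ltnS leq_addl.
    split.
      rewrite -(size_map Some); apply: leq_trans (leq_mul lea (leqnn M)).
      apply: (side_bound (X := X) au (None_notin_map _)
                (Y := map Some u2 ++ None :: map Some w1 ++ map Some w2 ++ Y)).
        by rewrite -XY WE -!catA /= -!catA.
      move=> V' aV'.
      have := ctx (V' ++ map Some u2 ++ None :: map Some w1 ++ map Some w2).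
      rewrite -!catA /= -!catA; apply; apply: dsym_N AP _.
      apply: dseq_cat aV' _; rewrite -cat_cons catA; exact: dseq_cons xW cw.
    rewrite -(size_map Some); apply: leq_trans (leq_mul lec (leqnn M)).
    apply: (side_bound (X := X ++ map Some u1 ++ map Some u2 ++ None :: map Some w1)
              cw (None_notin_map _) (Y := Y)).
      by rewrite -XY WE -!catA /= -!catA.
    move=> V' cV'; have := ctx (map Some u1 ++ map Some u2 ++ None :: map Some w1 ++ V').
    rewrite -!catA /= -!catA; apply; apply: dsym_N AP _.
    apply: dseq_cat au _; rewrite -cat_cons catA; exact: dseq_cons xW cV'.
  have {}step : spine_from (b * M) x u2 w1.
    refine (step _) => W' xW'.
    have := ctx (map Some u1 ++ W' ++ map Some w2).
    rewrite -!catA; apply; apply: dsym_N AP _.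
    by apply: dseq_cat au _; apply: dseq_cons xW' cw.
  case: x {rE AP le xW stepH} edge step => [B|t] edge.
    exact: prun_step (edge (Some B) erefl).

  move=> [tE -> ->]; apply: prun_step (edge None _) _; first by rewrite tE.
  left.
- by case: u.
- move=> x r U V xU IHU rV IHV u w /hash_split[].
    move=> [u1 [u2 [UE VE ->]]].
    have [a [y [c [v1 [v2 [w1 [w2 [-> -> -> au [cw yW IHy]]]]]]]]] := IHV _ _ VE.
    exists (x :: a), y, c, (u1 ++ v1), v2, w1, w2; rewrite -catA; split=> //.
    by rewrite map_cat -UE; apply: dseq_cons.
  move=> [w1 [w2 [UE VE ->]]].
  exists [::], x, r, [::], u, w1, w2; split=> //; first by left.
  split; rewrite -?VE -?UE // => X Y XY ctx; exact: IHU UE XY ctx.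
Qed.

End Complete.
End Spine.

(** A linear grammar simulates the transducer: states are nonterminals, an edge labelled [(u, v)]
    writes [u] on the left and the inverse of [v] on the right, and a final state may produce #. The
    extra nonterminal [None] chooses an initial state. *)
Lemma context_free_of_rational (S : finType) (finv : S -> S)
    (Rel : seq S -> seq S -> Prop) :
  rational_transduction Rel ->
  context_free (fun x => exists u v,
    Rel u v /\ x = map Some u ++ None :: map Some (winv finv v)).
Proof.
move=> [Q [I [F [edges RelP]]]].
pose rhs (u v : seq S) (q : Q) : seq (option Q + option S) :=
  map inr (map Some u) ++ inl (Some q) :: map inr (map Some (winv finv v)).
pose prods := [seq (Some e.1.1, rhs e.1.2.1 e.1.2.2 e.2) | e <- edges]
  ++ [seq (Some q, [:: inr None]) | q <- enum F]
  ++ [seq (None, [:: inl (Some q)]) | q <- enum I].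
pose word (u v : seq S) := map Some u ++ None :: map Some (winv finv v).
exists (option Q), None, prods => W.
have wordD u1 v1 u2 v2 :
    map Some u1 ++ word u2 v2 ++ map Some (winv finv v1) = word (u1 ++ u2) (v1 ++ v2).
  by rewrite /word winv_cat !map_cat -!catA.
split=> [[u [v [/RelP[q [q' [Iq Fq' r]]] ->]]]|].
  have {}r : dsym prods (inl (Some q)) (word u v).
    elim: r Fq' => {q q' Iq u v} [q Fq|q u v q' q'' u' v' e_in _ IH /IH D].
      apply: (@dsym_N _ _ prods (Some q) [:: inr None]); last by apply: dseq1; left.
      rewrite !mem_cat; apply/orP; right; apply/orP; left.
      by apply/mapP; exists q; rewrite // mem_enum.
    apply: (@dsym_N _ _ prods (Some q) (rhs u v q')).
      rewrite !mem_cat; apply/orP; left.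
      by apply/mapP; exists (q, (u, v), q').
    rewrite -wordD; apply: dseq_cat; first exact/dseq_terminals.
    by apply: dseq_cons D _; apply/dseq_terminals.
  apply: (@dsym_N _ _ prods None [:: inl (Some q)]); last exact: dseq1.
  rewrite !mem_cat; apply/orP; right; apply/orP; right.
  by apply/mapP; exists q; rewrite // mem_enum.
pose from q W := exists q' u v, [/\ F q', trun edges q q' u v & W = word u v].
pose P (x : option Q + option S) W := match x with
  | inl None => exists2 q, I q & from q W
  | inl (Some q) => from q W
  | inr t => W = [:: t] end.
(* Every right-hand side consists of one symbol between two terminal words, so sequences of this
   shape suffice for the induction. *)
suff [H _] : (forall x W, dsym prods x W -> P x W) /\
    (forall r W, dseq prods r W -> forall a x b, r = map inr a ++ x :: map inr b ->
      exists2 W', W = a ++ W' ++ b & P x W').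
  move=> /H[q Iq [q' [u [v [Fq' r ->]]]]]; exists u, v; split=> //.
  by apply/RelP; exists q, q'.
apply: derivation_ind => [//|A r {}W|[]//|x r U V xU PU rV IHV a y b].
  rewrite !mem_cat => /or3P[] /mapP[].
  - move=> [[q [u v]] q'] e_in /= [-> ->] _ /(_ _ _ _ erefl)[W' -> ].
    move=> [q'' [u' [v' [Fq'' r' ->]]]]; exists q'', (u ++ u'), (v ++ v').
    by split=> //; apply: trun_step r'.
  - move=> q; rewrite mem_enum => Fq [-> ->] _ /(_ [::] _ [::] erefl)[W' -> ->].
    by exists q, [::], [::]; split=> //; left.
  - move=> q; rewrite mem_enum => Iq [-> ->] _ /(_ [::] _ [::] erefl)[W' -> ].
    by rewrite /= cats0; exists q.
case: a => [|t a] /= [xE rE].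
  by exists U; rewrite -?xE //; rewrite rE in rV; move/dseq_terminals: rV => ->.
have [W' -> PW'] := IHV _ _ _ rE; exists W' => //.
by rewrite xE /= in PU; rewrite PU.
Qed.

(** * Combings *)

Section Group.
Variables (S : finType) (finv : S -> S).
Variables (G : Type) (mul : G -> G -> G) (one : G) (inv : G -> G) (f : seq S -> G).
Hypothesis HG : is_group mul one inv.
Hypothesis Hgen : choice_of_generators finv mul one inv f.

Let finvK : involutive finv.
Proof. by have [[]] := Hgen. Qed.
Let fM u v : f (u ++ v) = mul (f u) (f v).
Proof. by have [] := Hgen. Qed.
Let fV w : f (winv finv w) = inv (f w).
Proof. by have [] := Hgen. Qed.
Let winv2 w : winv finv (winv finv w) = w.
Proof. exact: winvK. Qed.

Lemma mulKl x y z : mul x y = mul x z -> y = z.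
Proof.
have [A one1 _ iv _] := HG.
by move/(congr1 (mul (inv x))); rewrite !A iv !one1.
Qed.

Lemma mulKr x y z : mul y x = mul z x -> y = z.
Proof.
have [A _ one1 _ vi] := HG.
by move/(congr1 (mul^~ (inv x))); rewrite -!A vi !one1.
Qed.

Lemma mul_eq_one x y : mul x y = one <-> x = inv y.
Proof.
have [A _ one1 iv vi] := HG.
split=> [xy|->]; last exact: iv.
by apply: (@mulKr y); rewrite iv.
Qed.

Lemma invK x : inv (inv x) = x.
Proof. by symmetry; apply/mul_eq_one; have [] := HG. Qed.

(** Writing the second half as an inverse turns membership in [C(g)] into multiplication by [g], the
    form in which transductions compose. *)
Lemma ClangP R g u v :
  Clang mul one f R g (map Some u ++ None :: map Some (winv finv v)) <->
  [/\ R u, R (winv finv v) & mul (f u) g = f v].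
Proof.
split=> [[u' [w [Ru Rw /mul_eq_one e /hash_inj[uE wE]]]]|[Ru Rw e]].
  by rewrite uE wE; split=> //; rewrite e -fV -wE winv2.
by exists u, (winv finv v); split=> //; apply/mul_eq_one; rewrite fV invK.
Qed.

(** As [V] has no #, it lies within [u] or within [w], and # stays in [X] or [Y]; so [V'] has none
    either. Both words satisfy the equation of [C(g)], and cancelling the common context leaves
    equal values of [v] and [v']. *)
Lemma Clang_replace R g X V Y V' u w :
  X ++ V ++ Y = map Some u ++ None :: map Some w -> None \notin V ->
  Clang mul one f R g (X ++ V ++ Y) -> Clang mul one f R g (X ++ V' ++ Y) ->
  exists v v', [/\ V = map Some v, V' = map Some v', f v' = f v &
    (exists x y, u = x ++ v ++ y /\ R (x ++ v' ++ y)) \/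
    (exists x y, w = x ++ v ++ y /\ R (x ++ v' ++ y))].
Proof.
move=> VE NV; rewrite VE => -[u0 [w0 [_ _ eV /hash_inj[uE wE]]]].
rewrite -{}uE -{}wE in eV => {u0 w0} -[u' [w' [Ru' Rw' eV' V'E]]].
have someI : injective (map (@Some S)) by apply: inj_map => x y [].
have [v [VE' []]] := hash_factor NV VE; move=> [x [y [XE YE uE]]].
  move: V'E; rewrite XE YE => /hash_split[[u1 [u2 [/someI <- + u'E]]]|]; last first.
    by move=> [w1 [w2 [/map_Some_hash]]].
  move=> /hash_split[[v' [u3 [V'E /hash_inj[u3E wE] u2E]]]|]; last first.
    by move=> [w1 [w2 [_ /esym/map_Some_hash]]].
  exists v, v'; split=> //; last by left; exists x, y; split=> //; rewrite u3E -u2E -u'E.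
  move: eV'; rewrite -eV u'E u2E uE -wE -u3E !fM.
  by move=> /mulKr/mulKr/mulKl/mulKr.
move: V'E; rewrite XE YE => /hash_split[[u1 [u2 [/esym/map_Some_hash]]] //|].
move=> [w1 [w2 [/hash_inj[u1E w1E] + w'E]]].
move=> /esym/map_eq_cat[v' [w3 [w2E V'E /someI w3E]]].
exists v, v'; split=> //; 
  last by right; exists x, y; split=> //; rewrite w3E -w2E w1E -w'E.
move: eV'; rewrite -eV w'E w2E uE -u1E -w1E -w3E !fM.
by move=> /mulKl/mulKl/mulKr.
Qed.

(** The grammar is exposed and [M] left free because later arguments choose [M] from the yields of
    the nonterminals. *)
Lemma rational_part R g : context_free (Clang mul one f R g) ->
  exists (N : finType) (prods : seq (N * seq (N + option S))) (start : N),
  [/\ (forall W, Clang mul one f R g W <-> dsym prods (inl start) W) &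
  forall M, 0 < M -> exists Rel : seq S -> seq S -> Prop,
  [/\ rational Rel,
      forall u v, Rel u v ->
        Clang mul one f R g (map Some u ++ None :: map Some (winv finv v)) &
      forall u w, Clang mul one f R g (map Some u ++ None :: map Some w) ->
        (forall X B V Y, X ++ V ++ Y = map Some u ++ None :: map Some w ->
           None \notin V -> dsym prods (inl B) V ->
           (forall V', dsym prods (inl B) V' ->
              Clang mul one f R g (X ++ V' ++ Y)) -> size V <= M) ->
        Rel u (winv finv w)]].
Proof.
move=> [N [start [prods LP]]]; exists N, prods, start; split=> // M M0.
pose b := \max_(p <- prods) size p.2.
have sizeb A rhs : (A, rhs) \in prods -> size rhs <= b.
  by move=> AP; apply: (@leq_bigmax_seq _ prods predT (fun p => size p.2) (A, rhs)).
exists (fun u v => prun (spine_edge finv prods (b * M)) (Some start) None u v); split.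
- exists (option N), (fun s => s = Some start), (fun s => s = None).
  exists (spine_edge finv prods (b * M)), (b * M).
  split=> [q u v q' [A [a [c []]]] //|u v].
  by split=> [r|[q [q' [-> -> //]]]]; exists (Some start), None.
- by move=> u v /spine_sound uv; apply/LP.
- move=> u w /LP uw bound.
  have [H _] := spine_complete_rec finvK M0 sizeb bound.
  by apply: (H _ _ uw [::] [::]) => //= [|W' /LP]; rewrite cats0.
Qed.

Definition shortest_in (R : language S) (u : seq S) :=
  R u /\ forall u', R u' -> f u' = f u -> size u <= size u'.

(** Let [M] bound the shortest yields of the productive nonterminals. Putting such a yield in place
    of [V] keeps the value and membership in [R], so minimality of [u] and [w] forces [V] to be no
    longer. *)
Lemma shortest_in_rational R g : context_free (Clang mul one f R g) ->
  exists Rel : seq S -> seq S -> Prop,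
  [/\ rational Rel,
      forall u v, Rel u v -> [/\ R u, R (winv finv v) & mul (f u) g = f v] &
      forall u w, shortest_in R u -> shortest_in R w ->
        mul (f u) g = f (winv finv w) -> Rel u (winv finv w)].
Proof.
move=> /rational_part[N [prods [start [LP ratM]]]].
have [M MP] : exists M, forall B, (exists V, dsym prods (inl B) V) ->
    exists2 V, dsym prods (inl B) V & size V <= M.
  apply: uniform_bound => [B m n mn H /H[V BV Vm]|B].
    by exists V; rewrite ?(leq_trans Vm).
  case: (pselect (exists V, dsym prods (inl B) V)) => [[V BV]|nB].
    by exists (size V) => _; exists V.
  by exists 0 => /nB.
(* The successor makes the bound positive, as [ratM] demands. *)
have [Rel [ratRel RelP Relc]] := ratM M.+1 isT.
exists Rel; split=> // [u v /RelP/ClangP //|u w [Ru minu] [Rw minw] e].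
have uw : Clang mul one f R g (map Some u ++ None :: map Some w).
  by rewrite -(winv2 w); apply/ClangP; rewrite winv2.
apply: Relc => // X B V Y VE NV BV ctx.
have [V' BV' V'M] := MP B (ex_intro _ V BV).
have [v [v' [VEv V'E fv' H]]] := Clang_replace VE NV (ctx _ BV) (ctx _ BV').
suff: size V <= size V' by move=> /leq_trans/(_ V'M)/leqW.
rewrite VEv V'E !size_map.
have cancel x y : size (x ++ v ++ y) <= size (x ++ v' ++ y) -> size v <= size v'.
  by rewrite !size_cat leq_add2l leq_add2r.
by case: H => -[x [y [uE RE]]]; apply: (cancel x y); rewrite -uE;
  [apply: minu|apply: minw]; rewrite ?uE ?fM ?fv'.
Qed.

(** * Words without short shortenable factors *)

Section Reduced.
Variables (K : finType) (tau : seq S -> K).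

(** [tau] will be the action of a word on the states of the automaton of [D]; only finiteness of its
    range matters until then. *)
Definition shortenable (v : seq S) :=
  exists v', [/\ size v' < size v, tau v' = tau v & f v' = f v].

Definition reduced (n : nat) (w : seq S) :=
  forall x v y, w = x ++ v ++ y -> size v <= n -> ~ shortenable v.

(** Here [M] is uniform over pairs of a nonterminal and a value of [tau], so any longer yield can be
    exchanged for a shorter one with the same [tau]; that the group value agrees too follows from
    the context. *)
Lemma reduced_rational R g : context_free (Clang mul one f R g) ->
  exists n, exists Rel : seq S -> seq S -> Prop,
  [/\ rational Rel,
      forall u v, Rel u v -> [/\ R u, R (winv finv v) & mul (f u) g = f v] &
      forall u w, R u -> R w -> reduced n u -> reduced n w ->
        mul (f u) g = f (winv finv w) -> Rel u (winv finv w)].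
Proof.
move=> /rational_part[N [prods [start [LP ratM]]]].
have [M MP] : exists M, forall p : N * K,
    (exists v, dsym prods (inl p.1) (map Some v) /\ tau v = p.2) ->
    exists v, [/\ dsym prods (inl p.1) (map Some v), tau v = p.2 & size v <= M].
  apply: uniform_bound => [p m n mn H /H[v [? ? vm]]|p].
    by exists v; split=> //; apply: leq_trans mn.
  case: (pselect (exists v, dsym prods (inl p.1) (map Some v) /\ tau v = p.2)).
    by move=> [v [? ?]]; exists (size v) => _; exists v.
  by move=> np; exists 0 => /np.
have [Rel [ratRel RelP Relc]] := ratM M.+1 isT.
pose b := \max_(p <- prods) size p.2.
have sizeb A rhs : (A, rhs) \in prods -> size rhs <= b.
  by move=> AP; apply: (@leq_bigmax_seq _ prods predT (fun p => size p.2) (A, rhs)).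
(* This is the upper length given by [medium_factor] at threshold [M.+1]: the factor it finds is
   short enough for reducedness to forbid it. *)
exists (b * M.+1), Rel; split=> // [u v /RelP/ClangP //|u w Ru Rw redu redw e].
have uw : Clang mul one f R g (map Some u ++ None :: map Some w).
  by rewrite -(winv2 w); apply/ClangP; rewrite winv2.
apply: Relc => // X B V Y VE NV BV ctx.
have [//|[B' [X' [V1 [Y' [VE1 BV1 /andP[ltV1 leV1] ctx1]]]]]] :=
  medium_factor (ltn0Sn M) sizeb BV ctx.
have NV1 : None \notin V1 by move: NV; rewrite VE1 !mem_cat !negb_or => /and3P[].
have VE' : (X ++ X') ++ V1 ++ (Y' ++ Y) = map Some u ++ None :: map Some w.
  by rewrite -VE VE1 -!catA.
have [v [V1E _]] := hash_factor NV1 VE'.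
have [|v' [BV' tauv' v'M]] := MP (B', tau v).
  by exists v; rewrite -V1E.
have [v1 [v1' [V1E' v'E fv' H]]] := Clang_replace VE' NV1 (ctx1 _ BV1) (ctx1 _ BV').
have someI : injective (map (@Some S)) by apply: inj_map => x y [].
rewrite V1E in V1E'; move/someI: V1E' => V1E'; move/someI: v'E => v'E; subst.
rewrite size_map in ltV1 leV1.
have short : shortenable v1.
  by exists v1'; split=> //; apply: leq_ltn_trans v'M (ltnW ltV1).
by case: H => -[x [y [uE _]]]; [case: (redu x v1 y uE leV1)|case: (redw x v1 y uE leV1)].
Qed.

End Reduced.

Lemma combing_to_async R : combing f R ->
  (forall a : option S, context_free (Clang mul one f R (f (eps_word a)))) ->
  exists R', (forall w, R' w -> R' (winv finv w)) /\ async_automatic mul f R'.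
Proof.
have [A one1 one2 iv vi] := HG; have [_ f0 _ fsurj _] := Hgen.
move=> combR cfR.
have [Rel1 [rat1 sound1 complete1]] := shortest_in_rational (cfR None).
pose D u := exists w, Rel1 u w.
have DR u : D u -> R u by move=> [w /sound1[]].
(* The partner of [u] is a shortest word of [R] for the inverse value. *)
have shortD u : shortest_in R u -> D u.
  move=> su; have [w [Rw fw] minw] := shortest (combR (inv (f u))).
  exists (winv finv w); apply: complete1 => //.
    by split=> // u' Ru' fu'; apply: minw; rewrite fu'.
  by rewrite /= f0 one2 fV fw invK.
have [Q [q0 [delta [F DP]]]] : regular D := regular_domain rat1.
pose tau v := [ffun q => foldl delta q v].
have tauD x v v' y : tau v' = tau v -> D (x ++ v ++ y) -> D (x ++ v' ++ y).
  move=> /ffunP/(_ (foldl delta q0 x)); rewrite !ffunE => e.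
  by rewrite !DP !foldl_cat e.
have [n nP] : exists n, forall a : option S, exists Rel : seq S -> seq S -> Prop,
  [/\ rational Rel,
      forall u v, Rel u v ->
        [/\ R u, R (winv finv v) & mul (f u) (f (eps_word a)) = f v] &
      forall u w, R u -> R w -> reduced tau n u -> reduced tau n w ->
        mul (f u) (f (eps_word a)) = f (winv finv w) -> Rel u (winv finv w)].
  (* Being reduced is a stronger condition for larger [n], so completeness survives an increase of
     [n]. *)
  apply: uniform_bound => [a m n mn [Rel [? ? H]]|a]; last exact: reduced_rational.
  exists Rel; split=> // u w Ru Rw redu redw; apply: H => // x v y e vm.
    by apply: (redu x v y e); apply: leq_trans mn.
  by apply: (redw x v y e); apply: leq_trans mn.
pose P u := D u /\ reduced tau n u.
pose P' u := P (winv finv u).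
have regP : regular P.
  apply: regularI; first exact: regular_domain.
  exact: regular_avoiding.
(* A shortest word of [R] shows that [D] attains [g]. A shortest word of [D] with value [g] is then
   reduced, since replacing a shortenable factor would stay in [D] by [tauD] and keep the value. *)
have combP g : exists u, P u /\ f u = g.
  have [r [Rr fr] minr] := shortest (combR g).
  have Dr : D r by apply: shortD; split=> // u' Ru' fu'; apply: minr; rewrite fu'.
  have [u [Du fu] minu] := shortest (ex_intro (fun u => D u /\ f u = g) r (conj Dr fr)).
  exists u; split=> //; split=> // x v y uE _ [v' [ltv tauv fv]].
  have := minu (x ++ v' ++ y); rewrite uE !size_cat leq_add2l leq_add2r leqNgt ltv.
  suff H : D (x ++ v' ++ y) /\ f (x ++ v' ++ y) = g by move=> /(_ H).
  by split; [apply: tauD tauv _; rewrite -uE|rewrite -fu uE !fM fv].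
pose PP' a u v := [/\ P u, P' v & mul (f u) (f (eps_word a)) = f v].
have ratPP' a : rational (PP' a).
  have [Rel [ratRel RelP Relc]] := nP a.
  apply: rational_ext (rational_restrict ratRel regP (regular_winv finv regP)).
  move=> u v; split=> [[/RelP[_ _ e] Pu Pv]|[Pu P'v e]]; first by split.
  split=> //; rewrite -(winv2 v); apply: Relc; rewrite ?winv2 //.
  - by case: Pu => /DR.
  - by case: P'v => /DR.
  - by case: Pu.
  - by case: P'v.
pose P'P a u v := [/\ P' u, P v & mul (f u) (f (eps_word a)) = f v].
have ratP'P a : rational (P'P a).
  (* Multiplying by [a] from [u] to [v] is multiplying by its inverse from [v] to [u]. *)
  apply: rational_ext (rational_swap (ratPP' (omap finv a))) => u v.
  have eps : f (eps_word (omap finv a)) = inv (f (eps_word a)).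
    by rewrite -fV; case: a.
  rewrite /PP' /P'P eps.
  split=> [[Pv P'u <-]|[P'u Pv <-]]; split=> //; first by rewrite -A iv one2.
  by rewrite -A vi one2.
have ext0 g : mul g (f (eps_word None)) = g by rewrite /= f0 one2.
have combP' g : exists u, P' u /\ f u = g.
  have [u [Pu fu]] := combP (inv g); exists (winv finv u).
  by rewrite /P' winv2 fV fu invK.
exists (fun u => P u \/ P' u); split=> [w|].
  by rewrite /P' winv2 => -[]; [right|left].
split; last split.
- by move=> g; have [u [Pu fu]] := combP g; exists u; split=> //; left.
(* The union is the domain of the equality relations between [P] and [P']: each word of either set
   has a partner of equal value in the other. *)
- have := regular_domain (rationalU (ratPP' None) (ratP'P None)).
  move=> [Q' [q' [d' [F' H]]]]; exists Q', q', d', F' => u; rewrite -H.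
  split=> [[Pu|P'u]|[v [[]|[]]]]; [| |by left|by right].
    by have [v [P'v fv]] := combP' (f u); exists v; left; split; rewrite ?ext0.
  by have [v [Pv fv]] := combP (f u); exists v; right; split; rewrite ?ext0.
- move=> a; apply/rational_transductionP.
  (* Pairs inside one set pass through a word [z] of the other set with the value of [u]. *)
  apply: rational_ext (rationalU (rationalU (ratPP' a) (ratP'P a))
    (rationalU (rational_comp (ratPP' None) (ratP'P a))
               (rational_comp (ratP'P None) (ratPP' a)))) => u w.
  rewrite /PP' /P'P; split.
    case=> [[[? ? ?]|[? ? ?]]|[[z [[? _ e0] [_ ? e1]]]|[z [[? _ e0] [_ ? e1]]]]].
    + by split; [left|right|].
    + by split; [right|left|].
    + by split; [left|left|rewrite -e1 -e0 ext0].
    + by split; [right|right|rewrite -e1 -e0 ext0].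
  case=> [[Pu|P'u] [Pw|P'w] e].
  + right; left; have [z [P'z fz]] := combP' (f u).
    by exists z; rewrite ext0 fz.
  + by left; left.
  + by left; right.
  + right; right; have [z [Pz fz]] := combP (f u).
    by exists z; rewrite ext0 fz.
Qed.

(** Closure under inverses makes [w] and its inverse belong to [R] together, so [C(a)] is exactly
    the multiplication relation with its second component inverted. *)
Lemma async_to_combing R :
  (forall w, R w -> R (winv finv w)) -> async_automatic mul f R ->
  forall a : option S, context_free (Clang mul one f R (f (eps_word a))).
Proof.
move=> RV [combR [_ ratR]] a.
have [N [start [prods LP]]] := context_free_of_rational finv (ratR a).
exists N, start, prods => W; rewrite -LP; split=> [[u [w [Ru Rw e ->]]]|].
  exists u, (winv finv w); rewrite winv2; split=> //; split=> //; first exact: RV.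
  by rewrite fV; apply/mul_eq_one.
by move=> [u [v [[Ru Rv e] ->]]]; apply/ClangP; split=> //; apply: RV.
Qed.

End Group.

Theorem theorem1p3 (S : finType) (finv : S -> S)
  (G : Type) (mul : G -> G -> G) (one : G) (inv : G -> G)
  (f : seq S -> G)
  (HG : is_group mul one inv)
  (Hgen : choice_of_generators finv mul one inv f) :
  (exists R : language S,
      combing f R /\
      forall a : option S, context_free (Clang mul one f R (f (eps_word a))))
  <->
  (exists R' : language S,
      (forall w, R' w -> R' (winv finv w)) /\ async_automatic mul f R').
Proof.
split=> [[R [combR cfR]]|[R' [invR' autR']]].
  exact: combing_to_async HG Hgen R combR cfR.
exists R'; split; first by case: autR'.
exact: async_to_combing HG Hgen _ invR' autR'.
Qed.
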